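(* Let $A$ be a Noetherian commutative ring, let $I \subseteq A$ be any ideal and let $s$ be a positive integer. Set $$K = \bigcap_{\substack{\mathfrak{p} \in \operatorname{Ass}_A^*(I) \\ \operatorname{grade}(\mathfrak{p}, A/I) \ge 1}} \mathfrak{p} \quad\text{ and }\quad K_s = \bigcap_{\substack{\mathfrak{p} \in \operatorname{Ass}_A(I^s) \\ \operatorname{grade}(\mathfrak{p},A/I) \ge 1}} \mathfrak{p}.$$ Let $x \in K$ be any element that is regular on $A/I$ if $\{\mathfrak{p} \in \operatorname{Ass}_A^*(I) \mid \operatorname{grade}(\mathfrak{p},A/I)\ge 1\}\neq \emptyset$, and $x = 1$ otherwise. Then $${}^{\mathtt a}I^{(s)} = I^{(s)}_K = I^{(s)}_{K_s} = I^{(s)}_{(x)}.$$ In particular, given an arbitrary irredundant primary decomposition of $I^s$, ${}^{\mathtt a}I^{(s)}$ is the intersection of its components that are primary to ideals $\mathfrak{p}\in \operatorname{Ass}_A(I^s)$ such that $\operatorname{grade}(\mathfrak{p},A/I)=0$, i.e., such that $\mathfrak{p}$ is contained in an element of $\operatorname{Ass}_A(I)$.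
   Context: For an ideal $I$ of a Noetherian commutative ring $A$: $\operatorname{Ass}_A(I)$ denotes the set of associated primes of $A/I$; $\operatorname{Ass}_A^*(I) = \bigcup_{n=1}^\infty \operatorname{Ass}_A(I^n)$, which is a finite set. An empty intersection of ideals of $A$ is $A$. For an ideal $\mathfrak{p}$ and a finitely generated $A$-module $M$, $\operatorname{grade}(\mathfrak{p},M)$ is the maximal length of an $M$-regular sequence in $\mathfrak{p}$ (and $+\infty$ if $\mathfrak{p}M=M$). The $s$-th symbolic power defined by associated primes is ${}^{\mathtt a}I^{(s)} = \bigcap_{\mathfrak{p} \in \operatorname{Ass}_A(I)} (I^sA_{\mathfrak{p}} \cap A)$, where $\cap\, A$ means preimage under $A\to A_{\mathfrak{p}}$. For an ideal $K$ of $A$, the $s$-th saturated power of $I$ with respect to $K$ is $I^{(s)}_K = I^s : K^\infty = \bigcup_{t\ge 1}(I^s : K^t)$. *)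

(* Defs.v *)
From HB Require Import structures.
From mathcomp Require Import all_boot all_order all_algebra.
From mathcomp Require Import ring.
From mathcomp Require Import boolp classical_sets constructive_ereal.

Set Implicit Arguments.
Unset Strict Implicit.
Unset Printing Implicit Defensive.

Import GRing.Theory.
Local Open Scope ring_scope.
Local Open Scope quotient_scope.
Local Open Scope classical_set_scope.

Identity Coercion fun_of_set : set >-> Funclass.

Record submod (A : comPzRingType) (V : lmodType A) := Submod {
  submod_set :> set V;
  submod0 : submod_set 0;
  submodD : forall u v, submod_set u -> submod_set v -> submod_set (u + v);
  submodZ : forall a v, submod_set v -> submod_set (a *: v)
}.

(* MathComp's [idealr] excludes the unit ideal and the zero ring, so ideals are
   taken to be the submodules of the regular module. *)
Notation ideal A := (submod A^o).

Section Submodules.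
Variables (A : comPzRingType) (V : lmodType A).

Definition fullm : submod V := @Submod A V [set: V] I
  (fun _ _ _ _ => I) (fun _ _ _ => I).

Section Intersection.
Variables (T : Type) (D : set T) (F : T -> submod V).

Lemma capm0 : (\bigcap_(i in D) F i) 0.
Proof. by move=> i _; apply: submod0. Qed.

Lemma capmD u v : (\bigcap_(i in D) F i) u -> (\bigcap_(i in D) F i) v ->
  (\bigcap_(i in D) F i) (u + v).
Proof.
by move=> uF vF i Di; apply: submodD; [apply: uF | apply: vF].
Qed.

Lemma capmZ a v : (\bigcap_(i in D) F i) v -> (\bigcap_(i in D) F i) (a *: v).
Proof. by move=> vF i Di; apply/submodZ/vF. Qed.

Definition capm : submod V := Submod capm0 capmD capmZ.

End Intersection.

Definition span (X : set V) : submod V :=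
  capm [set N : submod V | X `<=` N] id.

Definition mulm (J : ideal A) (N : submod V) : submod V :=
  span [set a *: v | a in J & v in N].

End Submodules.

Arguments fullm {A} V.

Definition ideal_gen (A : comPzRingType) (X : set A) : ideal A :=
  span (V := A^o) X.

Section QuotientModule.
Variables (A : comPzRingType) (V : lmodType A) (N : submod V).

Definition submod_pred : {pred V} := fun v => `[< N v >].

Lemma submod_pred_zmod_closed : zmod_closed submod_pred.
Proof.
split=> [|u v /asboolP uN /asboolP vN]; apply/asboolP; first exact: submod0.
by rewrite -scaleN1r; apply/submodD/submodZ.
Qed.

HB.instance Definition _ :=
  GRing.isZmodClosed.Build V submod_pred submod_pred_zmod_closed.

Definition quotm := Quotient.quot submod_pred.

HB.instance Definition _ := GRing.Zmodule.on quotm.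
HB.instance Definition _ : EqQuotient V (Quotient.equiv submod_pred) quotm :=
  EqQuotient.on quotm.

Lemma quotm_eq (u v : V) : (u == v %[mod quotm]) = `[< N (u - v) >].
Proof. by rewrite -Quotient.idealrBE. Qed.

Lemma quotm_pi0 : \pi_quotm 0 = 0.
Proof. exact: (raddf0 \pi_(Quotient.quot submod_pred)). Qed.

Lemma quotm_piD : {morph \pi_quotm : u v / u + v}.
Proof. exact: (raddfD \pi_(Quotient.quot submod_pred)). Qed.

Definition quotm_scale (a : A) (x : quotm) : quotm := \pi_quotm (a *: repr x).

Lemma quotm_scale_pi a v : quotm_scale a (\pi_quotm v) = \pi_quotm (a *: v).
Proof.
apply/eqP; rewrite quotm_eq -scalerBr; apply/asboolP/submodZ/asboolP.
by rewrite -quotm_eq reprK.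
Qed.

Lemma quotm_scaleA a b x :
  quotm_scale a (quotm_scale b x) = quotm_scale (a * b) x.
Proof. by rewrite -[x]reprK (quotm_scale_pi b) !quotm_scale_pi scalerA. Qed.

Lemma quotm_scale1 : left_id 1 quotm_scale.
Proof. by move=> x; rewrite -[x]reprK quotm_scale_pi scale1r. Qed.

Lemma quotm_scaleDr : right_distributive quotm_scale +%R.
Proof.
move=> a x y; rewrite -[x]reprK -[y]reprK.
by rewrite -quotm_piD !quotm_scale_pi scalerDr quotm_piD.
Qed.

Lemma quotm_scaleDl x : {morph quotm_scale^~ x : a b / a + b}.
Proof.
by move=> a b; rewrite -[x]reprK !quotm_scale_pi scalerDl quotm_piD.
Qed.

HB.instance Definition _ := GRing.Zmodule_isLmodule.Build A quotm
  quotm_scaleA quotm_scale1 quotm_scaleDr quotm_scaleDl.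

End QuotientModule.

Section Localization.
Variables (A : comPzRingType) (S : mulrClosed A).

Local Notation frac := (A * {u : A | u \in S})%type.

Definition locequiv (x y : frac) : bool :=
  `[< exists2 u, u \in S & u * (x.1 * sval y.2) = u * (y.1 * sval x.2) >].

Lemma locequiv_refl : reflexive locequiv.
Proof. by move=> x; apply/asboolP; exists 1; rewrite ?rpred1. Qed.

Lemma locequiv_sym : symmetric locequiv.
Proof. by move=> x y; apply/asboolP/asboolP => -[u uS e]; exists u. Qed.

Lemma locequiv_trans : transitive locequiv.
Proof.
move=> y x z /asboolP[u uS xy] /asboolP[v vS yz].
apply/asboolP; exists (u * v * sval y.2); first by rewrite !rpredM ?(valP y.2).
transitivity (u * (x.1 * sval y.2) * (v * sval z.2)); first by ring.
rewrite xy; transitivity (v * (y.1 * sval z.2) * (u * sval x.2)); first by ring.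
by rewrite yz; ring.
Qed.

Canonical locequiv_equiv :=
  EquivRel locequiv locequiv_refl locequiv_sym locequiv_trans.

Definition loc := {eq_quot locequiv}.

HB.instance Definition _ : EqQuotient _ locequiv loc := EqQuotient.on loc.
HB.instance Definition _ := Choice.on loc.

Lemma locP (x y : frac) :
  reflect (exists2 u, u \in S & u * (x.1 * sval y.2) = u * (y.1 * sval x.2))
          (x == y %[mod loc]).
Proof. by rewrite eqmodE; apply: asboolP. Qed.

Definition den1 : {u : A | u \in S} := exist _ 1 (rpred1 S).
Definition denM (u v : {u : A | u \in S}) : {u : A | u \in S} :=
  exist _ (sval u * sval v) (rpredM (valP u) (valP v)).

Definition addfrac (x y : frac) : frac :=
  (x.1 * sval y.2 + y.1 * sval x.2, denM x.2 y.2).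
Definition oppfrac (x : frac) : frac := (- x.1, x.2).
Definition mulfrac (x y : frac) : frac := (x.1 * y.1, denM x.2 y.2).

Definition loc_tofrac (a : A) : loc := \pi_loc (a, den1).
Definition loc_add (x y : loc) : loc := \pi_loc (addfrac (repr x) (repr y)).
Definition loc_opp (x : loc) : loc := \pi_loc (oppfrac (repr x)).
Definition loc_mul (x y : loc) : loc := \pi_loc (mulfrac (repr x) (repr y)).

Lemma loc_addE x y : loc_add (\pi_loc x) (\pi_loc y) = \pi_loc (addfrac x y).
Proof.
have /eqP/locP[u uS xE] := reprK (\pi_loc x).
have /eqP/locP[v vS yE] := reprK (\pi_loc y).
rewrite /loc_add; move: (repr _) (repr _) xE yE => y' x' xE yE.
apply/eqP/locP; exists (u * v); first by rewrite rpredM.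
rewrite /=; transitivity (u * (x'.1 * sval x.2) * (v * sval y.2 * sval y'.2)
  + v * (y'.1 * sval y.2) * (u * sval x.2 * sval x'.2)); first by ring.
by rewrite xE yE; ring.
Qed.

Lemma loc_oppE x : loc_opp (\pi_loc x) = \pi_loc (oppfrac x).
Proof.
have /eqP/locP[u uS xE] := reprK (\pi_loc x).
rewrite /loc_opp; move: (repr _) xE => x' xE.
by apply/eqP/locP; exists u; rewrite //= !mulNr !mulrN xE.
Qed.

Lemma loc_mulE x y : loc_mul (\pi_loc x) (\pi_loc y) = \pi_loc (mulfrac x y).
Proof.
have /eqP/locP[u uS xE] := reprK (\pi_loc x).
have /eqP/locP[v vS yE] := reprK (\pi_loc y).
rewrite /loc_mul; move: (repr _) (repr _) xE yE => y' x' xE yE.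
apply/eqP/locP; exists (u * v); first by rewrite rpredM.
rewrite /=; transitivity (u * (x'.1 * sval x.2) * (v * (y'.1 * sval y.2))).
  by ring.
by rewrite xE yE; ring.
Qed.

Lemma loc_addA : associative loc_add.
Proof.
elim/quotW=> x; elim/quotW=> y; elim/quotW=> z.
rewrite (loc_addE y z) (loc_addE x y) !loc_addE.
by apply/eqP/locP; exists 1; rewrite ?rpred1 //=; ring.
Qed.

Lemma loc_addC : commutative loc_add.
Proof.
elim/quotW=> x; elim/quotW=> y; rewrite !loc_addE.
by apply/eqP/locP; exists 1; rewrite ?rpred1 //=; ring.
Qed.

Lemma loc_add0 : left_id (loc_tofrac 0) loc_add.
Proof.
elim/quotW=> x; rewrite loc_addE.
by apply/eqP/locP; exists 1; rewrite ?rpred1 //=; ring.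
Qed.

Lemma loc_addN : left_inverse (loc_tofrac 0) loc_opp loc_add.
Proof.
elim/quotW=> x; rewrite loc_oppE loc_addE.
by apply/eqP/locP; exists 1; rewrite ?rpred1 //=; ring.
Qed.

HB.instance Definition _ :=
  GRing.isZmodule.Build loc loc_addA loc_addC loc_add0 loc_addN.

Lemma loc_mulA : associative loc_mul.
Proof.
elim/quotW=> x; elim/quotW=> y; elim/quotW=> z.
rewrite (loc_mulE y z) (loc_mulE x y) !loc_mulE.
by apply/eqP/locP; exists 1; rewrite ?rpred1 //=; ring.
Qed.

Lemma loc_mulC : commutative loc_mul.
Proof.
elim/quotW=> x; elim/quotW=> y; rewrite !loc_mulE.
by apply/eqP/locP; exists 1; rewrite ?rpred1 //=; ring.
Qed.

Lemma loc_mul1 : left_id (loc_tofrac 1) loc_mul.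
Proof.
elim/quotW=> x; rewrite loc_mulE.
by apply/eqP/locP; exists 1; rewrite ?rpred1 //=; ring.
Qed.

Lemma loc_mulDl : left_distributive loc_mul loc_add.
Proof.
elim/quotW=> x; elim/quotW=> y; elim/quotW=> z.
rewrite (loc_addE x y) !loc_mulE loc_addE.
by apply/eqP/locP; exists 1; rewrite ?rpred1 //=; ring.
Qed.

HB.instance Definition _ := GRing.Zmodule_isComPzRing.Build loc
  loc_mulA loc_mulC loc_mul1 loc_mulDl.

Lemma loc_tofrac_zmod_morphism : zmod_morphism loc_tofrac.
Proof.
move=> a b; rewrite -[- loc_tofrac b]/(loc_opp _) loc_oppE.
rewrite -[RHS]/(loc_add _ _) loc_addE.
by apply/eqP/locP; exists 1; rewrite ?rpred1 //=; ring.
Qed.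

Lemma loc_tofrac_monoid_morphism : monoid_morphism loc_tofrac.
Proof.
split=> // a b; rewrite -[RHS]/(loc_mul _ _) loc_mulE.
by apply/eqP/locP; exists 1; rewrite ?rpred1 //=; ring.
Qed.

HB.instance Definition _ :=
  GRing.isZmodMorphism.Build A loc loc_tofrac loc_tofrac_zmod_morphism.
HB.instance Definition _ :=
  GRing.isMonoidMorphism.Build A loc loc_tofrac loc_tofrac_monoid_morphism.

End Localization.

Record prime_ideal (A : comPzRingType) := PrimeIdeal {
  prime_ideal_ideal :> ideal A;
  prime_ideal1 : ~ prime_ideal_ideal 1;
  prime_idealM : forall a b : A, prime_ideal_ideal (a * b) ->
    prime_ideal_ideal a \/ prime_ideal_ideal b
}.

Section PrimeLocalization.
Variables (A : comPzRingType) (p : prime_ideal A).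

Definition primeC : {pred A} := fun a => `[< ~ p a >].

Lemma primeC_mulr_closed : mulr_closed primeC.
Proof.
split=> [|a b /asboolP ap /asboolP bp]; apply/asboolP.
  exact: prime_ideal1.
by move=> /prime_idealM[].
Qed.

HB.instance Definition _ := GRing.isMulClosed.Build A primeC primeC_mulr_closed.

Definition loc_prime : comPzRingType := loc primeC.
Definition to_loc_prime : {rmorphism A -> loc_prime} := @loc_tofrac A primeC.

End PrimeLocalization.

Section CommutativeAlgebra.
Variable A : comPzRingType.
Implicit Types (I J K Q : ideal A) (p q : prime_ideal A) (M : lmodType A).

Definition noetherian : Prop :=
  forall J, exists s : seq A, J = ideal_gen [set` s] :> set A.

Definition idealX I n : ideal A := iter n (mulm I) (fullm A^o).

Definition Ass M : set (prime_ideal A) :=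
  [set p | exists m : M, p = [set a | a *: m = 0] :> set A].

Definition AssI I : set (prime_ideal A) := Ass (quotm I).

Definition AssI_star I : set (prime_ideal A) :=
  \bigcup_(n in [set n | (1 <= n)%N]) AssI (idealX I n).

Definition regular_on M (x : A) : Prop := forall m : M, x *: m = 0 -> m = 0.

(* The sequence x_1, ..., x_n is M-regular when x_i is regular on
   M / (x_1, ..., x_(i-1)) M for every i, and (x_1, ..., x_n) M <> M. *)
Definition regular_seq M (s : seq A) : Prop :=
  (forall i, (i < size s)%N ->
     regular_on (quotm (mulm (ideal_gen [set` take i s]) (fullm M))) s`_i) /\
  mulm (ideal_gen [set` s]) (fullm M) <> [set: M] :> set M.

Definition regular_length J M (n : nat) : Prop :=
  exists s : seq A, [/\ size s = n, [set` s] `<=` J & regular_seq M s].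

(* The value is also +oo when the lengths of the M-regular sequences in J have
   no maximum; this does not occur for M finitely generated over a Noetherian
   ring. *)
Definition grade J M : \bar int :=
  if pselect (mulm J (fullm M) = [set: M] :> set M) then +oo%E else
  if pselect (exists n, regular_length J M n /\
                        forall m, regular_length J M m -> (m <= n)%N)
    is left max_length then (Posz (projT1 (cid max_length)))%:E else +oo%E.

Definition symbolic_power I s : set A :=
  \bigcap_(p in AssI I)
    to_loc_prime p @^-1` ideal_gen (to_loc_prime p @` idealX I s).

Definition colon J K : set A := [set a | forall b, K b -> J (a * b)].

Definition saturated_power I s K : set A :=
  \bigcup_(t in [set t | (1 <= t)%N]) colon (idealX I s) (idealX K t).

Definition primary Q : Prop :=
  ~ Q 1 /\ forall a b : A, Q (a * b) -> Q a \/ exists n, Q (b ^+ n).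

Definition radical J : set A := [set a | exists n, J (a ^+ n)].

Definition primary_to p Q : Prop := primary Q /\ radical Q = p.

(* Irredundant means that no component can be omitted; distinct components may
   have the same radical. *)
Definition irredundant_primary_decomposition J n (Q : 'I_n -> ideal A) : Prop :=
  [/\ forall i, primary (Q i),
      J = \bigcap_i Q i :> set A &
      forall i, J <> \bigcap_(j in [set j | j != i]) Q j :> set A].

End CommutativeAlgebra.

(* Main.v *)
From HB Require Import structures.
Require Import Defs.
From mathcomp Require Import all_boot all_order all_algebra.
From mathcomp Require Import ring.
From mathcomp Require Import boolp classical_sets constructive_ereal.

Set Implicit Arguments.
Unset Strict Implicit.
Unset Printing Implicit Defensive.

Import GRing.Theory.
Local Open Scope ring_scope.
Local Open Scope quotient_scope.
Local Open Scope classical_set_scope.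

(** The four sets in the chain of equalities are compared through elements:
    [a] lies in the symbolic power when, for every [p] in Ass(I), some [u]
    outside [p] satisfies [u a] in [I^s] ([symbolic_powerP]).

    A saturation [I^s : K^oo] lies in the symbolic power as soon as [K] is
    contained in no [p] of Ass(I) ([saturated_power_sub_symbolic]). For the
    intersection [K] of the primes of positive grade in Ass*(I) this would
    follow from the finiteness of Ass*(I), but a weaker property is enough:
    for each prime [p], all the associated primes of the powers of [I] that are
    not contained in [p] share an element outside [p] ([AssI_idealX_common]).
    The reason is that the elements of the associated graded ring of [I] that
    are annihilated by some element outside [p] form an ideal. The associated
    graded ring is Noetherian, so that this ideal is annihilated by one element
    [f] outside [p] ([uniform_graded_torsion]). If [q = I^n : c] is prime and
    contains some [a] outside [p], then multiplying [c] repeatedly by [f]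
    climbs the powers of [I], because [a] kills each successive class; hence
    [f^n c] lies in [I^n], and [f] in [q]. The Noetherian property used here
    comes from the Hilbert basis theorem ([hilbert_basis]), applied to the Rees
    algebra of [I] inside the polynomials over [A].

    Conversely let [a] be in the symbolic power, and let [f] be in every prime
    of Ass(I^s) that lies in no prime of Ass(I). Were [f] not in the radical of
    [I^s : a], the ideal [I^s : a f^n] would be proper and stationary for large
    [n], and one of its associated primes [q] would avoid [f]. Then [q] lies in
    some [p] of Ass(I), while it contains the element [u] outside [p] for which
    [u a] is in [I^s]: a contradiction ([symbolic_sub_saturated_power]).

    The primes of grade zero on A/I are those consisting of zero divisors on
    A/I. They are contained in a prime of Ass(I) by prime avoidance, since
    finitely many primes of Ass(I) cover the zero divisors
    ([zero_divisors_sub_AssI]).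

    For a primary decomposition of [I^s], a component whose radical lies in
    some [p] of Ass(I) contains the symbolic power, by primariness. The
    remaining components have a radical that contains [K_s], so an element of
    the components of grade zero is multiplied into [I^s] by a power of each
    element of [K_s], and hence lies in [I^s : K_s^oo]. *)

(** * Ideals of a commutative ring *)

Section Ideals.
Variable A : comPzRingType.
Implicit Types (I J K L : ideal A) (p q : prime_ideal A) (a b c d x y : A).

Lemma idealD J a b : J a -> J b -> J (a + b).
Proof. exact: submodD. Qed.

Lemma ideal_mull J a b : J b -> J (a * b).
Proof. exact: (submodZ (s := J)). Qed.

Lemma ideal_mulr J a b : J a -> J (a * b).
Proof. by move=> Ja; rewrite mulrC; apply: ideal_mull. Qed.

Lemma idealB J a b : J a -> J b -> J (a - b).
Proof. by move=> Ja Jb; rewrite -mulN1r; apply/idealD/ideal_mull. Qed.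

Lemma ideal_sum J (T : Type) (r : seq T) (P : pred T) (F : T -> A) :
  (forall i, P i -> J (F i)) -> J (\sum_(i <- r | P i) F i).
Proof.
move=> JF; elim/big_rec: _ => [|i a Pi Ja]; first exact: submod0.
by apply: idealD => //; apply: JF.
Qed.

Lemma ideal1E J : J 1 -> J = [set: A] :> set A.
Proof.
move=> J1; apply/seteqP; split=> // a _.
by rewrite -[a]mulr1; apply: ideal_mull.
Qed.

Lemma mem_ideal_gen (X : set A) a : X a -> ideal_gen X a.
Proof. by move=> Xa N; apply. Qed.

Lemma ideal_gen_sub (X : set A) J : X `<=` J -> ideal_gen X `<=` J.
Proof. by move=> XJ a; apply. Qed.

Lemma mem_mulm I J a b : I a -> J b -> mulm I J (a * b).
Proof. by move=> Ia Jb N; apply; exists a => //; exists b. Qed.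

Lemma mulm_sub I J L :
  (forall a b, I a -> J b -> L (a * b)) -> mulm I J `<=` L.
Proof. by move=> IJL c; apply => _ [a Ia [b Jb <-]]; apply: IJL. Qed.

Lemma idealX_sub I J n : I `<=` J -> idealX I n `<=` idealX J n.
Proof.
move=> IJ; elim: n => [//|n IHn]; apply: mulm_sub => a b Ia Ib.
by apply: mem_mulm; [apply: IJ | apply: IHn].
Qed.

Lemma idealX_exp I a n : I a -> idealX I n (a ^+ n).
Proof. by move=> Ia; elim: n => [//|n IHn]; rewrite exprS; apply: mem_mulm. Qed.

Lemma idealX_le I m n : (m <= n)%N -> idealX I n `<=` idealX I m.
Proof.
move=> /subnK <-; elim: (n - m)%N => [//|k IHk]; rewrite addSn.
apply: mulm_sub => a b _ /IHk; exact: ideal_mull.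
Qed.

(** The ideal [J : c]. *)
Definition colon_elt J c : ideal A.
Proof.
exists [set a | J (a * c)] => /= [|a b|b a].
- by rewrite mul0r; apply: submod0.
- by rewrite mulrDl; apply: idealD.
- by rewrite -mulrA; apply: ideal_mull.
Defined.

(** The ideal [J : K]. *)
Definition colon_ideal J K : ideal A.
Proof.
exists (colon J K) => /= [b _|a b Ja Jb c Kc|b a Ja c Kc].
- by rewrite mul0r; apply: submod0.
- by rewrite mulrDl; apply: idealD; [apply: Ja | apply: Jb].
- by rewrite -mulrA; apply/ideal_mull/Ja.
Defined.

Lemma idealXM I m n a b :
  idealX I m a -> idealX I n b -> idealX I (m + n) (a * b).
Proof.
elim: m a b => [|m IHm] a b Ia Ib; first exact: ideal_mull.
apply: (Ia (colon_elt (idealX I (m.+1 + n)) b)).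
by move=> _ [c Ic [d Id <-]]; rewrite /= -mulrA; apply/mem_mulm/IHm.
Qed.

Lemma prime_exp p a n : p (a ^+ n) -> p a.
Proof.
elim: n => [/prime_ideal1//|n IHn].
by rewrite exprS => /prime_idealM[|/IHn].
Qed.

(** A prime ideal that contains none of finitely many ideals does not contain
    their intersection. *)
Lemma prime_cap (T : eqType) (r : seq T) (F : T -> ideal A) p :
  (forall i, i \in r -> ~ F i `<=` p) ->
  exists2 a, ~ p a & forall i, i \in r -> F i a.
Proof.
elim: r => [|i r IHr] Fp; first by exists 1 => //; apply: prime_ideal1.
have [|a pa Fa] := IHr; first by move=> j jr; apply: Fp; rewrite inE jr orbT.
have [b Fb pb] : exists2 b, F i b & ~ p b.
  apply: contrapT => nb; apply: (Fp i); first by rewrite inE eqxx.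
  by move=> b Fb; apply: contrapT => pb; apply: nb; exists b.
exists (a * b) => [/prime_idealM[]//|j].
by rewrite inE => /predU1P[-> | /Fa]; [apply: ideal_mull | apply: ideal_mulr].
Qed.

Lemma prime_avoidance (T : eqType) (r : seq T) (P : T -> prime_ideal A) J :
  (forall i, i \in r -> ~ J `<=` P i) ->
  exists2 a, J a & forall i, i \in r -> ~ P i a.
Proof.
have [n] := ubnP (size r); elim: n r => // n IHn [|i r] /=.
  by exists 0 => //; apply: submod0.
rewrite ltnS => rn JP.
have [|x Jx Px] := IHn _ rn.
  by move=> j jr; apply: JP; rewrite inE jr orbT.
have [Pix|] := pselect (P i x); last first.
  by exists x => // j; rewrite inE => /predU1P[->|/Px].
have Ji : ~ J `<=` P i by apply: JP; rewrite inE eqxx.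
have [rPi|/existsNP[j /not_implyP[jr /contrapT ji]]] :=
  pselect (forall j, j \in r -> ~ P j `<=` P i); last first.
  (* avoiding P i implies avoiding P j, so that j may be dropped *)
  have [||y Jy Py] := IHn (i :: rem j r).
  - by rewrite /= size_rem // prednK //; case: (r) jr.
  - move=> k; rewrite inE => /predU1P[-> //|/mem_rem kr].
    by apply: JP; rewrite inE kr orbT.
  have Piy : ~ P i y by apply: Py; rewrite inE eqxx.
  exists y => // k; rewrite inE => /predU1P[-> //|kr].
  have [-> /ji//|kj] := eqVneq k j.
  apply: Py; rewrite inE; apply/orP; right.
  by move: kr; rewrite (perm_mem (perm_to_rem jr)) inE (negPf kj).
(* y lies in J and in every P j for j in r, but not in P i; the index None
   stands for J *)
pose F := oapp (fun j => P j : ideal A) J.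
have [|y Piy Fy] := @prime_cap _ (None :: map Some r) F (P i).
  by move=> j; rewrite inE => /predU1P[-> //|/mapP[k kr ->]]; apply: rPi.
exists (x + y) => [|j].
  by apply: idealD => //; apply: (Fy None); rewrite inE eqxx.
rewrite inE => /predU1P[-> Pxy|jr Pxy].
  by apply: Piy; rewrite -[y](addKr x) addrC; apply: idealB.
apply: (Px _ jr); rewrite -[x](addrK y); apply: idealB => //.
by apply: (Fy (Some j)); rewrite inE map_f ?orbT.
Qed.

Lemma pi_quotm0 (V : lmodType A) (N : submod V) v :
  \pi_(quotm N) v = 0 <-> N v.
Proof.
rewrite -quotm_pi0; split=> [/eqP|Nv].
  by rewrite quotm_eq subr0 => /asboolP.
by apply/eqP; rewrite quotm_eq subr0; apply/asboolP.
Qed.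

Lemma pi_quotmZ (V : lmodType A) (N : submod V) a v :
  a *: \pi_(quotm N) v = \pi_(quotm N) (a *: v).
Proof. exact: quotm_scale_pi. Qed.

Lemma AssIP J p : AssI J p <-> exists c, p = [set a | J (a * c)] :> set A.
Proof.
split=> [[m pE]|[c pE]].
  exists (repr m); rewrite pE; apply/seteqP; split=> a /= am.
    by apply/pi_quotm0; rewrite -pi_quotmZ reprK.
  by rewrite -[m]reprK pi_quotmZ; apply/pi_quotm0.
exists (\pi c); rewrite pE; apply/seteqP; split=> a /= am.
  by rewrite pi_quotmZ; apply/pi_quotm0.
by apply/pi_quotm0; rewrite -pi_quotmZ.
Qed.

Lemma AssI_sub J p : AssI J p -> J `<=` p.
Proof. by move=> /AssIP[c ->] a Ja; apply: ideal_mulr. Qed.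

Lemma regular_onP J x :
  regular_on (quotm J) x <-> forall a, J (x * a) -> J a.
Proof.
split=> [xreg a Jxa|xreg m].
  by apply/pi_quotm0/xreg; rewrite pi_quotmZ; apply/pi_quotm0.
rewrite -[m]reprK pi_quotmZ => /pi_quotm0/xreg Jm.
by apply/pi_quotm0.
Qed.

Lemma regular_notin_AssI J p x : AssI J p -> regular_on (quotm J) x -> ~ p x.
Proof.
move=> /AssIP[c pE] /regular_onP xreg; rewrite pE => /= /xreg Jc.
by apply: (@prime_ideal1 _ p); rewrite pE /= mul1r.
Qed.

(** * Noetherian rings *)

Section Noetherian.
Hypothesis noethA : noetherian A.

Lemma noetherian_acc (F : nat -> ideal A) :
  (forall n, F n `<=` F n.+1) -> exists n, forall m, F m `<=` F n.
Proof.
move=> Fn; have F_le m n : (m <= n)%N -> F m `<=` F n.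
  by move=> /subnK <-; elim: (n - m)%N => [//|k IHk] a /IHk; apply: Fn.
have U0 : (\bigcup_n F n) (0 : A^o) by exists 0 => //; apply: submod0.
have UD (u v : A^o) : (\bigcup_n F n) u -> (\bigcup_n F n) v ->
    (\bigcup_n F n) (u + v).
  move=> [m _ mu] [n _ nv]; exists (maxn m n) => //.
  by apply: submodD; [apply: F_le mu|apply: F_le nv];
    rewrite ?leq_maxl ?leq_maxr.
have UZ a (v : A^o) : (\bigcup_n F n) v -> (\bigcup_n F n) (a *: v).
  by move=> [n _ nv]; exists n => //; apply: submodZ.
pose U : ideal A := Submod U0 UD UZ.
have [r Ur] := noethA U.
have {}Ur_sub : exists n, [set` r] `<=` F n.
  have : [set` r] `<=` \bigcup_n F n.
    by move=> a ra; have : U a by rewrite Ur; apply: mem_ideal_gen.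
  elim: (r) => [_|a r' IHr rU]; first by exists 0.
  have [|m _ Fa] := rU a; first by rewrite /= inE eqxx.
  have [b /= br|n Fr] := IHr; first by apply: rU; rewrite /= inE br orbT.
  exists (maxn m n) => b /=; rewrite inE => /predU1P[->|/Fr Fb].
    by apply: F_le Fa; rewrite leq_maxl.
  by apply: F_le Fb; rewrite leq_maxr.
have [n rF] := Ur_sub; exists n => m a Fa.
by apply: (ideal_gen_sub rF); rewrite -Ur; exists m.
Qed.

Lemma noetherian_max (D : set (ideal A)) : D !=set0 ->
  exists2 M, D M & forall N, D N -> M `<=` N -> N `<=` M.
Proof.
move=> [M0 DM0]; apply: contrapT => nmax.
have next (M : {M | D M}) : exists N : {M | D M},
    sval M `<=` sval N /\ ~ sval N `<=` sval M.
  apply: contrapT => nN; apply: nmax; exists (sval M); first exact: svalP M.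
  move=> N DN MN; apply: contrapT => NM; apply: nN.
  by exists (exist _ N DN).
have [f fP] := choice next.
have [n Fn] := @noetherian_acc (fun n => sval (iter n f (exist _ M0 DM0)))
  (fun n => (fP _).1).
exact: (fP _).2 (Fn n.+1).
Qed.

(** The finite generating set may be chosen among given generators. *)
Lemma noetherian_gen (X : set A) :
  exists2 r : seq A, [set` r] `<=` X & X `<=` ideal_gen [set` r].
Proof.
pose D := [set J | exists2 r : seq A, [set` r] `<=` X & J = ideal_gen [set` r]].
have [|M [r rX ->] Mmax] := @noetherian_max D.
  by exists (ideal_gen [set` [::]]); exists [::] => // a.
exists r => // a Xa.
apply: (Mmax (ideal_gen [set` a :: r])).
- exists (a :: r) => // b /=.
  by rewrite inE => /predU1P[->//|/rX].
- apply: ideal_gen_sub => b br; apply: mem_ideal_gen.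
  by rewrite /= inE; apply/orP; right.
- by apply: mem_ideal_gen; rewrite /= inE eqxx.
Qed.

(** The annihilator of an element [c] outside [J] is contained in a maximal
    one. *)
Lemma maximal_annihilator J c : ~ J c ->
  exists d, [/\ ~ J d, colon_elt J c `<=` colon_elt J d &
    forall e, ~ J e -> colon_elt J d `<=` colon_elt J e ->
      colon_elt J e `<=` colon_elt J d].
Proof.
move=> Jc.
pose D := [set L | exists d, [/\ L = colon_elt J d, ~ J d &
  colon_elt J c `<=` colon_elt J d]].
have [|_ [d [-> Jd cd]] dmax] := @noetherian_max D.
  by exists (colon_elt J c); exists c; split=> // a.
exists d; split=> // e Je de; apply: dmax => //.
by exists e; split=> //; apply: subset_trans de.
Qed.

Lemma maximal_annihilator_prime J d : ~ J d ->
    (forall e, ~ J e -> colon_elt J d `<=` colon_elt J e ->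
      colon_elt J e `<=` colon_elt J d) ->
  exists p, p = colon_elt J d :> ideal A.
Proof.
move=> Jd dmax; have d1 : ~ colon_elt J d 1 by rewrite /= mul1r.
suff dM a b : colon_elt J d (a * b) -> colon_elt J d a \/ colon_elt J d b.
  by exists (PrimeIdeal d1 dM).
move=> Jabd; have [Jbd|Jbd] := pselect (J (b * d)); [by right|left].
apply: (dmax _ Jbd); last by rewrite /= mulrA.
by move=> e Jed; rewrite /= mulrCA; apply: ideal_mull.
Qed.

(** Every [J : c] other than the unit ideal has an associated prime, which is
    an associated prime of [J] as well. *)
Lemma exists_associated_prime J c : ~ J c ->
  exists2 p, AssI J p & exists d, p = [set a | J (a * (c * d))] :> set A.
Proof.
move=> Jc; have Lc : ~ colon_elt J c 1 by rewrite /= mul1r.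
have [d [Ld _ dmax]] := maximal_annihilator Lc.
have [p pE] := maximal_annihilator_prime Ld dmax.
have {}pE : p = [set a | J (a * (c * d))] :> set A.
  by rewrite pE; apply/seteqP; split=> a /=; rewrite -mulrA (mulrC d).
by exists p; [apply/AssIP; exists (c * d) | exists d].
Qed.

(** The maximal annihilators modulo [J] are finite in number, because the
    elements that they annihilate generate an ideal; their union is the set of
    the zero divisors modulo [J]. Each of them is indexed by an element [c] of
    [r] that it annihilates modulo [J]; the values of [P] outside [r] are
    arbitrary. *)
Lemma zero_divisors_in_finite_union J : ~ J 1 -> exists r : seq A,
  exists2 P : A -> prime_ideal A, forall c, c \in r -> AssI J (P c) &
    forall a, ~ regular_on (quotm J) a -> exists2 c, c \in r & P c a.
Proof.
move=> J1; have [p0 _ _] := exists_associated_prime J1.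
pose D := [set d | ~ J d /\ forall e, ~ J e ->
  colon_elt J d `<=` colon_elt J e -> colon_elt J e `<=` colon_elt J d].
have [r rD Dr] := noetherian_gen D.
have /choice[P PE] c : exists p : prime_ideal A,
    c \in r -> p = colon_elt J c :> ideal A.
  have [/rD[Jc cmax]|] := boolP (c \in r); last by exists p0.
  by have [p pE] := maximal_annihilator_prime Jc cmax; exists p.
exists r, P => [c cr|a areg]; first by apply/AssIP; exists c; rewrite PE.
have [m Jam Jm] : exists2 m, J (a * m) & ~ J m.
  apply: contrapT => nm; apply/areg/regular_onP => m Jam.
  by apply: contrapT => Jm; apply: nm; exists m.
have [d [Jd md dmax]] := maximal_annihilator Jm.
have [p pE] := maximal_annihilator_prime Jd dmax.
have [c cr cp] : exists2 c, c \in r & P c `<=` p.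
  apply: contrapT => nc.
  have [c cr cp|b pb Pb] := @prime_cap _ r P p; first by apply: nc; exists c.
  apply: pb; rewrite pE /= mulrC.
  apply: (@ideal_gen_sub [set` r] (colon_elt J b)); last exact: Dr.
  by move=> c cr /=; have := Pb c cr; rewrite PE //= mulrC.
exists c => //; rewrite PE //.
apply: ((rD c cr).2 d Jd) => [e ce|]; last exact: md.
by rewrite -pE; apply: cp; rewrite PE.
Qed.

Lemma zero_divisors_sub_AssI J K :
  (forall a, K a -> ~ regular_on (quotm J) a) ->
  exists2 p, AssI J p & K `<=` p.
Proof.
move=> Kreg; have J1 : ~ J 1.
  move=> /ideal1E J1; apply: (Kreg 0); first exact: submod0.
  by apply/regular_onP => a _; rewrite J1.
have [r [P PJ rP]] := zero_divisors_in_finite_union J1.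
apply: contrapT => nK.
have [c cr|a Ka Pa] := @prime_avoidance _ r P K.
  by move=> KP; apply: nK; exists (P c) => //; apply: PJ.
by have [c /Pa] := rP a (Kreg a Ka).
Qed.

(** The ideals [L : K^n] are stationary. An associated prime of the stationary
    value would contain [L], hence [K], so that an element defining it would
    already lie in that value. *)
Lemma idealX_sub_radical K L : K `<=` radical L ->
  exists t, (1 <= t)%N /\ idealX K t `<=` L.
Proof.
move=> KL.
have [n Ln] := @noetherian_acc (fun n => colon_ideal L (idealX K n))
  (fun n a La b Kb => La b (idealX_le (leqnSn n) Kb)).
exists n.+1; split=> //; set M := colon_ideal L (idealX K n).
suff /Ln M1 : colon_ideal L (idealX K n.+1) 1.
  by move=> a /(idealX_le (leqnSn n)) Ka; rewrite -[a]mul1r; apply: M1.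
apply: contrapT => nM1.
have {}nM1 : ~ M 1.
  by move=> M1; apply: nM1 => a /(idealX_le (leqnSn n)); apply: M1.
have [p _ [d pE]] := exists_associated_prime nM1.
apply: (@prime_ideal1 _ p); rewrite pE /= !mul1r.
apply: (Ln n.+1) => b; rewrite mulrC.
apply: (@mulm_sub K (idealX K n) (colon_elt L d)) => {}b c Kb Kc.
rewrite /= mulrC mulrA [d * b]mulrC.
suff : p b by rewrite pE /= mul1r; apply.
have [k Lb] := KL b Kb; apply: (@prime_exp _ _ k).
by rewrite pE /= => e _; apply/ideal_mulr/ideal_mulr.
Qed.

End Noetherian.
End Ideals.

(** * The Hilbert basis theorem and the Rees algebra *)

Section HilbertBasis.
Variable R : comNzRingType.
Local Notation RX := ({poly R} : comPzRingType).
Implicit Types (J G : ideal RX).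

(** The coefficients of [X^n] in the elements of [J] of degree at most [n]. *)
Definition lead_ideal J (n : nat) : ideal R.
Proof.
exists [set c | exists P : {poly R}, [/\ J P, (size P <= n.+1)%N & P`_n = c]].
- by exists 0; split; [exact: submod0 | rewrite size_poly0 | rewrite coef0].
- move=> _ _ [P [JP sP <-]] [Q [JQ sQ <-]]; exists (P + Q).
  split; [exact: idealD | | by rewrite coefD].
  by rewrite (leq_trans (size_polyD _ _)) // geq_max sP.
- move=> a _ [P [JP sP <-]]; exists (a%:P * P); split.
  + exact: ideal_mull.
  + by rewrite mul_polyC (leq_trans (size_scale_leq _ _)).
  + by rewrite coefCM.
Defined.

Lemma lead_ideal_leS J n : lead_ideal J n `<=` lead_ideal J n.+1.
Proof.
move=> _ [P [JP sP <-]]; exists ('X * P); split; first exact: ideal_mull.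
  rewrite mulrC; have [->|P0] := eqVneq P 0; first by rewrite mul0r size_poly0.
  by rewrite size_mulX.
by rewrite coefXM.
Qed.

(** An element of [J] is reduced to an element of lower degree by subtracting
    an element of [G] with the same leading coefficient. *)
Lemma sub_lead_ideal J G : G `<=` J ->
  (forall n, lead_ideal J n `<=` lead_ideal G n) -> J `<=` G.
Proof.
move=> GJ JG; suff H n P : J P -> (size P <= n)%N -> G P by move=> P /H; apply.
elim: n P => [|n IHn] P JP sP.
  by move: sP; rewrite leqn0 size_poly_eq0 => /eqP ->; apply: submod0.
have [|Q [GQ sQ QP]] := JG n P`_n; first by exists P.
rewrite -[P](subrK Q); apply: idealD => //; apply: IHn.
  by apply: idealB => //; apply: GJ.
apply/leq_sizeP => j; rewrite leq_eqVlt => /predU1P[<-|nj].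
  by rewrite coefB QP subrr.
by rewrite coefB !nth_default ?subr0 // (leq_trans _ nj).
Qed.

Lemma lead_ideal_sub J G n : J `<=` G -> lead_ideal J n `<=` lead_ideal G n.
Proof. by move=> JG _ [P [JP sP <-]]; exists P; split=> //; apply: JG. Qed.

Theorem hilbert_basis : noetherian R -> noetherian RX.
Proof.
move=> noethR J.
have [N LN] := noetherian_acc noethR (@lead_ideal_leS J).
have lead_gen n : exists2 r : seq {poly R}, [set` r] `<=` J &
    lead_ideal J n `<=` lead_ideal (ideal_gen [set` r] : ideal RX) n.
  have [s sE] := noethR (lead_ideal J n).
  have /choice[P sP] c : exists P : {poly R}, c \in s ->
      [/\ J P, (size P <= n.+1)%N & P`_n = c].
    have [cs|] := boolP (c \in s); last by exists 0.
    have [P JP] : lead_ideal J n c by rewrite sE; apply: mem_ideal_gen.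
    by exists P.
  exists (map P s) => [_ /= /mapP[c /sP[JP _ _] ->] //|].
  rewrite sE; apply: ideal_gen_sub => c /= cs.
  have [JP szP Pc] := sP c cs; exists (P c); split=> //.
  by apply: mem_ideal_gen; apply: map_f.
have [r rJ rN] : exists2 r : seq {poly R}, [set` r] `<=` J &
    forall n, (n <= N)%N ->
      lead_ideal J n `<=` lead_ideal (ideal_gen [set` r] : ideal RX) n.
  elim: N {LN} => [|N [r rJ rN]].
    by have [r rJ rP] := lead_gen 0; exists r => // n; rewrite leqn0 => /eqP ->.
  have [r' r'J r'P] := lead_gen N.+1; exists (r ++ r') => [P /=|n].
    by rewrite mem_cat => /orP[/rJ|/r'J].
  rewrite leq_eqVlt => /predU1P[->|nN] c Jc.
    apply: (lead_ideal_sub _ (r'P c Jc)); apply: ideal_gen_sub => P Pr.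
    by apply: mem_ideal_gen; rewrite /= mem_cat; apply/orP; right.
  apply: (lead_ideal_sub _ (rN n nN c Jc)); apply: ideal_gen_sub => P Pr.
  by apply: mem_ideal_gen; rewrite /= mem_cat; apply/orP; left.
exists r; apply/seteqP; split; last exact: ideal_gen_sub.
apply: sub_lead_ideal => [|n]; first exact: ideal_gen_sub.
have [/rN//|/ltnW Nn] := leqP n N.
move=> c /LN /(rN N (leqnn N)); rewrite -(subnK Nn).
elim: (n - N)%N => [//|k IHk] /IHk; rewrite addSn; exact: lead_ideal_leS.
Qed.
End HilbertBasis.

(** A subalgebra generated by finitely many elements [s] over a Noetherian ring
    is a quotient of a Noetherian ring, namely of an iterated polynomial ring.
    The subalgebra is described by two bounds: the image of [g] contains its
    generators, and lies in any [B] that is closed under the operations and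
    contains them. *)
Lemma noetherian_adjoin (R C : comNzRingType) (f : {rmorphism R -> C})
    (s : seq C) (B : set C) :
    noetherian R -> (forall a, B (f a)) -> (forall x, x \in s -> B x) ->
    (forall x y, B x -> B y -> B (x + y)) ->
    (forall x y, B x -> B y -> B (x * y)) ->
  exists (S : comNzRingType) (g : {rmorphism S -> C}),
    [/\ noetherian S, range g `<=` B, range f `<=` range g &
      forall x, x \in s -> range g x].
Proof.
move=> noethR Bf Bs BD BM; elim: s Bs => [|x s IHs] Bs.
  by exists R, f; split=> // _ [a _ <-].
have [|S [g [noethS gB fg sg]]] := IHs.
  by move=> y ys; apply: Bs; rewrite inE ys orbT.
have gx : commr_rmorph g x by move=> a; apply: mulrC.
have gpC a : horner_morph gx a%:P = g a by apply: horner_morphC.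
exists {poly S}, (horner_morph gx); split.
- exact: hilbert_basis.
- move=> _ [P _ <-]; elim/poly_ind: P => [|P c BP].
    by rewrite rmorph0 -(rmorph0 f).
  rewrite rmorphD rmorphM /= horner_morphX gpC.
  apply: BD; first by apply: BM => //; apply: Bs; rewrite inE eqxx.
  by apply: gB; exists c.
- move=> _ [a _ <-]; have [b _ gb] := fg (f a) (ex_intro2 _ _ a I erefl).
  by exists b%:P => //; rewrite /= gpC.
- move=> y; rewrite inE => /predU1P[->|/sg[a _ <-]].
    by exists 'X => //; apply: horner_morphX.
  by exists a%:P => //; rewrite /= gpC.
Qed.

(** The Rees algebra of [I], as the set of the polynomials whose coefficient of
    [X^n] lies in [I^n] for every [n]. *)
Definition rees (A : comNzRingType) (I : ideal A) : set {poly A} :=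
  [set P | forall n, idealX I n P`_n].

(** The Rees algebra is generated over [A] by the [a X], for the finitely many
    generators [a] of [I]. *)
Lemma rees_quotient_noetherian (A : comNzRingType) (I : ideal A) :
  noetherian A -> exists (S : comNzRingType) (g : {rmorphism S -> {poly A}}),
    noetherian S /\ range g = rees I.
Proof.
move=> noethA; have [s sE] := noethA I.
have [||||S [g [noethS gB Cg sg]]] := @noetherian_adjoin _ _
  (polyC : {rmorphism A -> {poly A}}) [seq a *: 'X | a <- s] (rees I) noethA.
- move=> a [//|n].
  by rewrite coefC; apply: (submod0 (idealX I n.+1)).
- move=> _ /mapP[a as_ ->] n; rewrite coefZ coefX.
  have [->|_] := eqVneq n 1; last by rewrite mulr0; apply: submod0.
  by apply: mem_mulm; rewrite ?sE //; apply: mem_ideal_gen.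
- by move=> P Q IP IQ n; rewrite coefD; apply: idealD.
- move=> P Q IP IQ n; rewrite coefM; apply: ideal_sum => i _.
  by have := idealXM (IP i) (IQ (n - i)%N); rewrite subnKC // -ltnS.
exists S, g; split=> //; apply/seteqP; split=> // P IP.
have gD x y : range g x -> range g y -> range g (x + y).
  by move=> [a _ <-] [b _ <-]; exists (a + b) => //; rewrite rmorphD.
have gM x y : range g x -> range g y -> range g (x * y).
  by move=> [a _ <-] [b _ <-]; exists (a * b) => //; rewrite rmorphM.
have gC a : range g a%:P by apply: Cg; exists a.
have L0 n : range g ((0 : A) *: 'X^n).
  by rewrite scale0r; exists 0; rewrite ?rmorph0.
have LD n (a b : A) : range g (a *: 'X^n) -> range g (b *: 'X^n) ->
    range g ((a + b) *: 'X^n).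
  by rewrite scalerDl; apply: gD.
have LZ n (a b : A) : range g (b *: 'X^n) -> range g ((a * b) *: 'X^n).
  by rewrite -scalerA -(mul_polyC a); apply: gM.
pose L n : ideal A := @Submod A A^o [set a | range g (a *: 'X^n)] (L0 n)
  (@LD n) (@LZ n).
have IL1 : I `<=` L 1.
  rewrite sE; apply: ideal_gen_sub => a as_.
  by apply: sg; rewrite expr1; apply/mapP; exists a.
have IL n : idealX I n `<=` L n.
  elim: n => [|n IHn].
    by move=> a _; rewrite /= expr0 alg_polyC; apply: gC.
  apply: mulm_sub => a b /IL1 ga /IHn gb.
  have := gM _ _ ga gb.
  by rewrite -scalerAl -scalerAr scalerA -exprD add1n.
rewrite -[P]coefK poly_def; elim/big_ind: _ => [|x y|i _].
- by exists 0; rewrite ?rmorph0.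
- exact: gD.
- exact: IL.
Qed.

(** The polynomial [y X^n] of the Rees algebra stands for the class of [y] in
    [I^n / I^(n+1)]. The [p]-torsion of the associated graded ring of [I] is
    annihilated as a whole by an element outside [p]: it is an ideal, hence
    finitely generated, and each of its elements is annihilated by an element
    outside [p]. *)
Lemma uniform_graded_torsion_nz (A : comNzRingType) (I : ideal A)
    (p : prime_ideal A) : noetherian A ->
  exists2 f, ~ p f & forall n b y, ~ p b -> idealX I n y ->
    idealX I n.+1 (b * y) -> idealX I n.+1 (f * y).
Proof.
move=> noethA; have [S [g [noethS gE]]] := rees_quotient_noetherian I noethA.
have gI r n : idealX I n (g r)`_n.
  by have : range g (g r) by [exists r]; rewrite gE; apply.
(* b annihilates the image of g r in the associated graded ring *)
pose H b r := forall n, idealX I n.+1 (b * (g r)`_n).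
have Hl0 r : H 0 r by move=> n; rewrite mul0r; apply: submod0.
have HlD r b c : H b r -> H c r -> H (b + c) r.
  by move=> Hb Hc n; rewrite mulrDl; apply: idealD.
have HlZ r a b : H b r -> H (a * b) r.
  by move=> Hb n; rewrite -mulrA; apply: ideal_mull.
have Hr0 b : H b 0 by move=> n; rewrite rmorph0 coef0 mulr0; apply: submod0.
have HrD b r t : H b r -> H b t -> H b (r + t).
  by move=> Hb Hc n; rewrite rmorphD coefD mulrDr; apply: idealD.
have HrZ b t r : H b r -> H b (t * r).
  move=> Hb n; rewrite rmorphM coefM mulr_sumr; apply: ideal_sum => i _.
  rewrite mulrCA; have := idealXM (gI t i) (Hb (n - i)%N).
  by rewrite addnS subnKC // -ltnS.
pose F r : ideal A := @Submod A A^o [set b | H b r] (Hl0 r) (@HlD r) (@HlZ r).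
pose W b : ideal S := @Submod S S^o [set r | H b r] (Hr0 b) (@HrD b) (@HrZ b).
pose TT := [set r | exists2 b, ~ p b & H b r].
have T0 : TT (0 : S^o) by exists 1 => //; apply: prime_ideal1.
have TD (r t : S^o) : TT r -> TT t -> TT (r + t).
  move=> [b pb Hr] [c pc Ht]; exists (b * c); first by case/prime_idealM.
  by apply: (HrD _ _ _); [rewrite mulrC|]; apply: (HlZ _ _ _).
have TZ a (r : S^o) : TT r -> TT (a *: r).
  by move=> [b pb Hr]; exists b => //; apply: (HrZ _ _ _).
have [rs TE] := noethS (Submod T0 TD TZ).
have [|f pf Ff] := @prime_cap A _ rs F p.
  move=> r rrs Fp; have [b pb Hr] : TT r.
    by rewrite -[TT]/(submod_set (Submod T0 TD TZ)) TE; apply: mem_ideal_gen.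
  exact/pb/Fp.
exists f => // n b y pb Iy Iby.
have [r _ gr] : range g (y *: 'X^n).
  rewrite gE => m; rewrite coefZ coefXn.
  by have [->|_] := eqVneq m n; rewrite ?mulr1 ?mulr0 //; apply: submod0.
have : TT r.
  exists b => // m; rewrite gr coefZ coefXn.
  have [->|_] := eqVneq m n; first by rewrite mulr1.
  by rewrite !mulr0; apply: submod0.
rewrite -[TT]/(submod_set (Submod T0 TD TZ)) TE.
have /ideal_gen_sub : [set` rs] `<=` W f by move=> t /Ff.
by move=> Wf /Wf /(_ n); rewrite gr coefZ coefXn eqxx mulr1.
Qed.

(** A ring in which [1 != 0], as an object of the class of nonzero rings. *)
Definition nonzero_ring (A : comPzRingType) (A1 : 1 != 0 :> A) : Type := A.

HB.instance Definition _ (A : comPzRingType) (A1 : 1 != 0 :> A) :=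
  GRing.ComPzRing.on (nonzero_ring A1).
HB.instance Definition _ (A : comPzRingType) (A1 : 1 != 0 :> A) :=
  GRing.PzSemiRing_isNonZero.Build (nonzero_ring A1) A1.

(** The two structures agree field by field, hence only once [A] is
    destructured. *)
Lemma nonzero_ringE (A : comPzRingType) (A1 : 1 != 0 :> A) :
  A = (nonzero_ring A1 : comNzRingType) :> comPzRingType.
Proof. by case: A A1 => T [*]. Qed.

Lemma uniform_graded_torsion (A : comPzRingType) (I : ideal A)
    (p : prime_ideal A) : noetherian A ->
  exists2 f, ~ p f & forall n b y, ~ p b -> idealX I n y ->
    idealX I n.+1 (b * y) -> idealX I n.+1 (f * y).
Proof.
have A1 : 1 != 0 :> A.
  by apply/eqP => A10; apply: (@prime_ideal1 _ p); rewrite A10; apply: submod0.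
have := nonzero_ringE A1; move: (nonzero_ring A1 : comNzRingType) => A' eA.
move: I p; rewrite {}eA => I p; exact: uniform_graded_torsion_nz.
Qed.

(** * Symbolic powers and grade *)

Section SymbolicPowers.
Variable A : comPzRingType.
Implicit Types (I J K L Q : ideal A) (p q : prime_ideal A) (a b c x : A).

(** The associated primes of all the powers of [I] that are not contained in
    the prime [p] have a common element outside [p]. *)
Lemma AssI_idealX_common I p : noetherian A ->
  exists2 f, ~ p f & forall n q, AssI (idealX I n) q -> ~ q `<=` p -> q f.
Proof.
move=> noethA; have [f pf fI] := uniform_graded_torsion I p noethA.
exists f => // n q /AssIP[c qE] /existsNP[a /not_implyP[qa pa]].
apply: (@prime_exp _ _ _ n); rewrite qE /=.
have Iac : idealX I n (a * c) by move: qa; rewrite qE.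
(* f^k c lies in I^k for all k <= n *)
suff H k : (k <= n)%N -> idealX I k (f ^+ k * c) by apply: H.
elim: k => [//|k IHk] kn; rewrite exprS -mulrA.
apply: (fI _ a) => //; first exact/IHk/ltnW.
by rewrite mulrCA; apply/ideal_mull/(idealX_le kn).
Qed.

Lemma to_loc_prime_eq p a b : to_loc_prime p a = to_loc_prime p b ->
  exists2 u, ~ p u & u * a = u * b.
Proof.
move=> /eqP/locP[u /asboolP pu]; rewrite /= !mulr1 => uab.
by exists u.
Qed.

Lemma loc_prime_frac p (z : loc_prime p) :
  exists c v, ~ p v /\ z * to_loc_prime p v = to_loc_prime p c.
Proof.
elim/quotW: z => -[c [v pv]]; exists c, v; split; first by move/asboolP: pv.
rewrite -[LHS]/(loc_mul _ _) loc_mulE.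
by apply/eqP/locP; exists 1; rewrite ?rpred1 //=; ring.
Qed.

Lemma loc_prime_inv p u : ~ p u -> exists w, w * to_loc_prime p u = 1.
Proof.
move=> pu; have uS : u \in primeC p by apply/asboolP.
exists (\pi_(loc (primeC p)) (1, exist _ u uS)).
rewrite -[LHS]/(loc_mul _ _) loc_mulE.
by apply/eqP/locP; exists 1; rewrite ?rpred1 //=; ring.
Qed.

(** The extension of [I^s] to the local ring at [p] consists of the fractions
    with numerator in [I^s]. *)
Lemma symbolic_powerP I s a : symbolic_power I s a <->
  forall p, AssI I p -> exists2 u, ~ p u & idealX I s (u * a).
Proof.
split=> [Ia p /Ia|Ia p /Ia[u pu Iua]].
  pose L : set (loc_prime p) := [set z | exists u b, [/\ ~ p u, idealX I s b &
    z * to_loc_prime p u = to_loc_prime p b]].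
  have L0 : L (0 : (loc_prime p)^o).
    exists 1, 0; split; [exact: prime_ideal1|exact: submod0|].
    by rewrite mul0r rmorph0.
  have LD (y z : (loc_prime p)^o) : L y -> L z -> L (y + z).
    move=> [u [b [pu Ib yE]]] [v [c [pv Ic zE]]].
    exists (u * v), (v * b + u * c); split; first by case/prime_idealM.
      by apply: idealD; apply: ideal_mull.
    rewrite rmorphD !rmorphM -yE -zE /=.
    rewrite -[(y + z : (loc_prime p)^o)]/(y + z : loc_prime p); ring.
  have LZ w (z : (loc_prime p)^o) : L z -> L (w *: z).
    have [c [v [pv wE]]] := loc_prime_frac w.
    move=> [u [b [pu Ib zE]]]; exists (v * u), (c * b).
    split; [by case/prime_idealM | exact: ideal_mull | ].
    by rewrite -[w *: z]/(w * z) !rmorphM -wE -zE; ring.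
  move=> /(_ (Submod L0 LD LZ)) [|u [b [pu Ib]]].
    move=> _ [b Ib <-]; exists 1, b; split=> //; first exact: prime_ideal1.
    by rewrite rmorph1 mulr1.
  rewrite -rmorphM => /to_loc_prime_eq[v pv vE].
  exists (v * u); first by case/prime_idealM.
  by rewrite -mulrA (mulrC u) vE; apply: ideal_mull.
have [w wu] := loc_prime_inv pu.
pose G : ideal (loc_prime p) := ideal_gen (to_loc_prime p @` idealX I s).
have aE : to_loc_prime p a = w * to_loc_prime p (u * a).
  by rewrite rmorphM mulrA wu mul1r.
suff : G (to_loc_prime p a) by []; rewrite aE.
by apply: (ideal_mull (J := G)); apply: mem_ideal_gen; exists (u * a).
Qed.

Lemma mulm_empty (M : lmodType A) m :
  mulm (ideal_gen [set` [::]]) (fullm M) m -> m = 0.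
Proof.
have zeroD (V : lmodType A) (u v : V) : u = 0 -> v = 0 -> u + v = 0.
  by move=> -> ->; rewrite addr0.
have zeroZ (V : lmodType A) a (v : V) : v = 0 -> a *: v = 0.
  by move=> ->; rewrite scaler0.
pose zerom (V : lmodType A) : submod V :=
  @Submod A V [set v | v = 0] erefl (@zeroD V) (@zeroZ V).
apply: (_ : mulm _ _ `<=` zerom M) => {}m; apply=> _ [a Xa [v _ <-]].
have /= -> : zerom A^o a by apply: Xa.
exact: scale0r.
Qed.

Lemma mulm_quotm_proper I J K : I `<=` J -> K `<=` J -> ~ J 1 ->
  mulm K (fullm (quotm I)) <> [set: quotm I] :> set _.
Proof.
move=> IJ KJ J1 KT; apply: J1.
pose N := [set m | exists2 b, J b & m = \pi_(quotm I) b].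
have N0 : N 0 by exists 0; [exact: submod0 | rewrite quotm_pi0].
have ND u v : N u -> N v -> N (u + v).
  move=> [b Jb ->] [c Jc ->]; exists (b + c); first exact: idealD.
  by rewrite quotm_piD.
have NZ a v : N v -> N (a *: v).
  move=> [b Jb ->]; exists (a * b); first exact: ideal_mull.
  exact: pi_quotmZ.
have : mulm K (fullm (quotm I)) (\pi 1) by rewrite KT.
move=> /(_ (Submod N0 ND NZ)) [|b Jb /eqP].
  move=> _ [a Ka [v _ <-]]; exists (a * repr v); first exact/ideal_mulr/KJ.
  by have := pi_quotmZ I a (repr v); rewrite reprK.
rewrite quotm_eq => /asboolP/IJ Jb1.
by rewrite -[1](subrK b); apply: idealD.
Qed.

(** Under these hypotheses A/I differs from its product by any ideal contained
    in [J], so that a regular element of [J] is already a regular sequence. *)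
Lemma regular_length_gt0P I J : I `<=` J -> ~ J 1 ->
  (exists2 n, (0 < n)%N & regular_length J (quotm I) n) <->
  exists2 x, J x & regular_on (quotm I) x.
Proof.
move=> IJ J1; split=> [[n n0 [[|x r] [sr rJ [/= xr _]]]]|[x Jx xreg]].
- by rewrite -sr in n0.
- exists x => [|m xm]; first by apply: rJ; rewrite /= inE eqxx.
  have := xr 0 isT (\pi m); rewrite pi_quotmZ xm quotm_pi0 => /(_ erefl).
  by move=> /pi_quotm0/mulm_empty.
exists 1 => //; exists [:: x].
have xJ : [set` [:: x]] `<=` J by move=> y /=; rewrite inE => /eqP ->.
split=> //; split; last exact/mulm_quotm_proper/J1/ideal_gen_sub.
case=> // _ m /=; rewrite -[m]reprK pi_quotmZ => /pi_quotm0/mulm_empty.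
by move=> /xreg ->; rewrite quotm_pi0.
Qed.

Lemma regular_length0 I J : I `<=` J -> ~ J 1 ->
  regular_length J (quotm I) 0.
Proof.
move=> IJ J1; exists [::]; split=> //; split=> //.
exact/mulm_quotm_proper/J1/ideal_gen_sub.
Qed.

Lemma grade_ge1P I J : I `<=` J -> ~ J 1 ->
  (1 <= grade J (quotm I))%E <-> exists2 x, J x & regular_on (quotm I) x.
Proof.
move=> IJ J1; apply: iff_trans (regular_length_gt0P IJ J1).
rewrite /grade; destruct (pselect _) as [JT|nJT].
  by case: (mulm_quotm_proper IJ (@subset_refl _ J) J1 JT).
rewrite /=; destruct (pselect _) as [h|nomax]; last first.
  split=> _; last by rewrite leey.
  apply: contrapT => npos; apply: nomax; exists 0.
  split=> [|n Jn]; first exact: regular_length0.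
  rewrite leqn0 -[_ == _]negbK -lt0n; apply/negP => n0.
  by apply: npos; exists n.
case: (cid h) => k [Jk kmax] /=; rewrite lee_fin.
split=> [k1|[n n0 /kmax nk]]; first by exists k.
exact: leq_trans n0 nk.
Qed.

Lemma grade_ge0 J (M : lmodType A) : (0 <= grade J M)%E.
Proof.
rewrite /grade; destruct (pselect _) => /=; first by rewrite leey.
by destruct (pselect _); rewrite ?leey ?lee_fin.
Qed.

Lemma grade_eq0P I J : I `<=` J -> ~ J 1 ->
  grade J (quotm I) = 0%E <-> forall x, J x -> ~ regular_on (quotm I) x.
Proof.
move=> IJ J1; have gP := grade_ge1P IJ J1.
split=> [g0 x Jx xreg|noreg].
  by have : (1 <= grade J (quotm I))%E; [apply/gP; exists x|rewrite g0].
have := grade_ge0 J (quotm I).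
have : ~ (1 <= grade J (quotm I))%E by move=> /gP[x /noreg].
case: (grade _ _) => [[[|n]|n]||] //.
Qed.
End SymbolicPowers.

(** * Saturated powers *)

Section SaturatedPowers.
Variable A : comPzRingType.
Hypothesis noethA : noetherian A.
Implicit Types (I J K L Q : ideal A) (p q : prime_ideal A) (a b c x : A).

Lemma AssI_idealX_sub I n p : AssI (idealX I n) p -> I `<=` p.
Proof.
by move=> pI a Ia; apply/prime_exp/(AssI_sub pI)/idealX_exp.
Qed.

Lemma grade_AssI_idealX_eq0P I n p : AssI (idealX I n) p ->
  grade p (quotm I) = 0%E <-> exists2 q, AssI I q & p `<=` q.
Proof.
move=> /AssI_idealX_sub Ip.
apply: iff_trans (grade_eq0P Ip (@prime_ideal1 _ p)) _.
split=> [|[q qI pq] x px xreg]; first exact: zero_divisors_sub_AssI.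
exact/(regular_notin_AssI qI xreg)/pq.
Qed.

Lemma grade_eq0_or_ge1 J (M : lmodType A) :
  grade J M = 0%E \/ (1 <= grade J M)%E.
Proof.
by have := grade_ge0 J M; case: (grade J M) => [[[|n]|n]||] //; [left|right..].
Qed.

Lemma saturated_powerS I s K L : K `<=` L ->
  saturated_power I s L `<=` saturated_power I s K.
Proof.
move=> KL a [t t1 La]; exists t => // b Kb; apply: La.
exact: idealX_sub Kb.
Qed.

Lemma mem_saturated_power I s K a :
  K `<=` radical (colon_elt (idealX I s) a) -> saturated_power I s K a.
Proof.
move=> /(idealX_sub_radical noethA)[t [t1 Kt]]; exists t => // b /Kt.
by rewrite /= mulrC.
Qed.

Lemma saturated_power_sub_symbolic I s K :
  (forall p, AssI I p -> ~ K `<=` p) ->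
  saturated_power I s K `<=` symbolic_power I s.
Proof.
move=> Kp a [t _ Ka]; apply/symbolic_powerP => p /Kp/existsNP[x].
move=> /not_implyP[Kx px]; exists (x ^+ t); first by move/prime_exp.
by rewrite mulrC; apply/Ka/idealX_exp.
Qed.

Lemma symbolic_sub_saturated_power I s K :
  (forall q, AssI (idealX I s) q ->
    K `<=` q \/ exists2 p, AssI I p & q `<=` p) ->
  symbolic_power I s `<=` saturated_power I s K.
Proof.
move=> Kq a /symbolic_powerP Ia; apply: mem_saturated_power => f Kf.
apply: contrapT => nf.
(* I^s : f^m a is stationary from m = n on, and then it is the quotient of
   itself by f, so that its associated primes avoid f *)
have [n Mn] := noetherian_acc noethA
  (F := fun n => colon_elt (idealX I s) (f ^+ n * a))
  (fun n b Ib => ltac:(by rewrite /= exprS -mulrA mulrCA; apply: ideal_mull)).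
have Ifa : ~ idealX I s (f ^+ n * a) by move=> Ifa; apply: nf; exists n.
have [q qI [d qE]] := exists_associated_prime noethA Ifa.
have qf : ~ q f.
  rewrite qE /= => Ifd; apply: (@prime_ideal1 _ q); rewrite qE /= mul1r.
  rewrite mulrC; apply: (Mn n.+1); rewrite /= exprS.
  have -> : d * (f * f ^+ n * a) = f * (f ^+ n * a * d) by ring.
  exact: Ifd.
have [/(_ f Kf)//|[p /Ia[u pu Iua] qp]] := Kq q qI.
apply/pu/qp; rewrite qE /=.
have -> : u * (f ^+ n * a * d) = f ^+ n * d * (u * a) by ring.
exact: ideal_mull.
Qed.

(** Each component of an irredundant primary decomposition belongs to an
    associated prime: if [c] lies in all the components but [Q i], then
    [J : c = Q i : c], whose associated primes all equal the radical of
    [Q i]. *)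
Lemma irredundant_component J n (Q : 'I_n -> ideal A) i :
  irredundant_primary_decomposition J Q ->
  exists2 p, AssI J p & primary_to p (Q i).
Proof.
move=> [Qprim JE Qirr].
have [c Qc nQc] : exists2 c, forall j, j != i -> Q j c & ~ Q i c.
  apply: contrapT => nc; apply: (Qirr i); rewrite JE; apply/seteqP; split.
    by move=> a Qa j _; apply: Qa.
  move=> a Qa j _; have [->|ji] := eqVneq j i; last exact: Qa.
  by apply: contrapT => Qia; apply: nc; exists a.
have JQ a : J (a * c) <-> Q i (a * c).
  rewrite JE; split=> [Qa|Qa j _]; first exact: Qa.
  by have [->//|/Qc] := eqVneq j i; apply: ideal_mull.
have Jc : ~ J c by rewrite -[c]mul1r => /JQ; rewrite mul1r.
have [p pJ [d pE]] := exists_associated_prime noethA Jc.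
exists p => //; split=> //.
have {}pE a : p a <-> Q i (a * (c * d)).
  by rewrite pE /= mulrA (mulrAC a); apply: JQ.
have Qcd : ~ Q i (c * d).
  by rewrite -[c * d]mul1r => /pE; apply: prime_ideal1.
apply/seteqP; split=> a; last first.
  move=> pa; have [_ Qi] := Qprim i.
  have /pE : p a by [].
  by rewrite mulrC => /Qi[].
move=> [k Qa]; suff : p a by [].
by apply: (@prime_exp _ _ _ k); apply/pE/ideal_mulr.
Qed.

End SaturatedPowers.

Theorem lemma2p2 (A : comPzRingType) (noethA : noetherian A) (I : ideal A)
    (s : nat) (s_gt0 : (0 < s)%N) :
  let Pstar := [set p | AssI_star I p /\ (1 <= grade p (quotm I))%E] in
  let Ps := [set p | AssI (idealX I s) p /\ (1 <= grade p (quotm I))%E] in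
  let K := capm Pstar (@prime_ideal_ideal A) in
  let Ks := capm Ps (@prime_ideal_ideal A) in
  [/\ symbolic_power I s = saturated_power I s K,
      saturated_power I s K = saturated_power I s Ks,
      forall x : A,
        (Pstar !=set0 -> K x /\ regular_on (quotm I) x) ->
        (Pstar = set0 -> x = 1) ->
        saturated_power I s Ks = saturated_power I s (ideal_gen [set x]),
      forall p : prime_ideal A, AssI (idealX I s) p ->
        grade p (quotm I) = 0%E <-> exists2 q, AssI I q & p `<=` q &
      forall (n : nat) (Q : 'I_n -> ideal A),
        irredundant_primary_decomposition (idealX I s) Q ->
        symbolic_power I s =
          \bigcap_(i in [set i | exists p : prime_ideal A,
              [/\ AssI (idealX I s) p, primary_to p (Q i) &
                  grade p (quotm I) = 0%E]]) Q i].
Proof.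
move=> Pstar Ps K Ks.
have PsPstar : Ps `<=` Pstar by move=> p [pI p1]; split=> //; exists s.
have KKs : K `<=` Ks by move=> a Ka p /PsPstar; apply: Ka.
have Kp p : AssI I p -> ~ K `<=` p.
  move=> pI; have [f pf fP] := AssI_idealX_common I p noethA.
  apply: contra_not pf; apply=> q [[n n1 qI] q1]; apply: (fP n) => // qp.
  have /grade_ge1P[//||x /qp px xreg] := q1; first exact: AssI_idealX_sub qI.
    exact: prime_ideal1.
  exact: (regular_notin_AssI pI xreg).
have symKs : symbolic_power I s `<=` saturated_power I s Ks.
  apply: symbolic_sub_saturated_power => // q qI.
  have [q0|q1] := grade_eq0_or_ge1 q (quotm I).
    by right; apply/(grade_AssI_idealX_eq0P noethA qI).
  by left=> a; apply.
have KsE : symbolic_power I s = saturated_power I s Ks.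
  apply/seteqP; split=> // a /(saturated_powerS KKs).
  exact: saturated_power_sub_symbolic.
have KE : symbolic_power I s = saturated_power I s K.
  apply/seteqP; split; last exact: saturated_power_sub_symbolic.
  by rewrite KsE; apply: saturated_powerS.
split=> //; first by rewrite -KE.
- move=> x Kx x1.
  have [Ksx xreg] : Ks x /\ regular_on (quotm I) x.
    have [/Kx[/KKs//]|/set0P/negP/negPn/eqP P0] := pselect (Pstar !=set0).
    rewrite x1 //; split=> [p /PsPstar|m]; first by rewrite P0.
    by rewrite scale1r.
  apply/seteqP; split.
    by apply/saturated_powerS/ideal_gen_sub => _ ->.
  rewrite -KsE; apply: saturated_power_sub_symbolic => p pI xp.
  by apply: (regular_notin_AssI pI xreg); apply/xp/mem_ideal_gen.
- by move=> p; apply: grade_AssI_idealX_eq0P.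
move=> n Q Qdec; apply/seteqP; split=> [a /symbolic_powerP Ia i [p]|a Qa].
  move=> [pI [[_ Qprim] Qp] /(grade_AssI_idealX_eq0P noethA pI)[q qI pq]].
  have [u qu] := Ia q qI; have [_ JE _] := Qdec; rewrite JE => /(_ i Logic.I).
  rewrite mulrC => /Qprim[//|Qu]; case: qu; apply: pq.
  by rewrite -Qp.
rewrite KsE; apply: mem_saturated_power => // f Ksf.
have /choice[N QN] i : exists N, Q i (f ^+ N * a).
  have [p pI Qp] := irredundant_component noethA i Qdec.
  have [p0|p1] := grade_eq0_or_ge1 p (quotm I).
    by exists 0; rewrite mul1r; apply: Qa; exists p.
  have : radical (Q i) f by rewrite Qp.2; apply: Ksf.
  by move=> [N QN]; exists N; apply: ideal_mulr.
have [_ JE _] := Qdec; exists (\max_i N i); rewrite /= JE => i _.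
rewrite -(subnK (leq_bigmax i)) exprD -mulrA.
exact: ideal_mull.
Qed.
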